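(* Let $q\geq 2$ be an integer and let $(X,\mathcal{B}_X,\mu,T)$ be a $\mathbb{Z}^q$-MPS. Then the following statements are equivalent. (a) There exist $q$ linearly independent directions $\vec{v}_i=(1,\beta^i_2,\ldots,\beta^i_q)\in\mathbb{R}^q$, $i=1,\ldots,q$, such that $\mu$ has $\vec{v}_i$-discrete spectrum for all $i=1,\ldots,q$. (b) $\mu$ has discrete spectrum.
   Context: A $\mathbb{Z}^q$-measure preserving dynamical system ($\mathbb{Z}^q$-MPS) is a quadruple $(X,\mathcal{B}_X,\mu,T)$ where $X$ is a compact metric space, $\mathcal{B}_X$ its Borel $\sigma$-algebra, $T$ assigns to each $\vec{w}\in\mathbb{Z}^q$ a homeomorphism $T^{\vec{w}}:X\to X$ with $T^{\vec{w}}\circ T^{\vec{u}}=T^{\vec{w}+\vec{u}}$ and $T^{\vec{0}}=\mathrm{id}_X$, and $\mu$ is a Borel probability measure on $X$ invariant under every $T^{\vec{w}}$. For $\vec{v}=(1,\beta_2,\ldots,\beta_q)\in\mathbb{R}^q$ and $\mathbf{b}=(b_2,\ldots,b_q)\in\mathbb{R}^{q-1}_+$ (all $b_i>0$), put $$\Lambda^{\vec{v}}(\mathbf{b})=\{(m_1,\ldots,m_q)\in\mathbb{Z}^q:\beta_i m_1-b_i/2\leq m_i\leq\beta_i m_1+b_i/2,\ i=2,\ldots,q\}.$$ Let $U_T^{\vec{w}}f=f\circ T^{\vec{w}}$ for $f\in L^2(X,\mathcal{B}_X,\mu)$. The $\vec{v}$-directional Kronecker algebra is $$\mathcal{K}_\mu^{\vec{v}}=\left\{B\in\mathcal{B}_X:\overline{\{U_T^{\vec{w}}1_B:\vec{w}\in\Lambda^{\vec{v}}(\mathbf{b})\}}\text{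 is compact in }L^2(X,\mathcal{B}_X,\mu)\right\};$$ it is a $\sigma$-algebra and does not depend on the choice of $\mathbf{b}\in\mathbb{R}^{q-1}_+$. $\mu$ has $\vec{v}$-discrete spectrum if $\mathcal{K}_\mu^{\vec{v}}=\mathcal{B}_X$. The (classical) Kronecker algebra $\mathcal{K}_\mu$ consists of all $B\in\mathcal{B}_X$ such that $\overline{\{U_T^{\vec{w}}1_B:\vec{w}\in\mathbb{Z}^q\}}$ is compact in $L^2(X,\mathcal{B}_X,\mu)$; $\mu$ has discrete spectrum if $\mathcal{K}_\mu=\mathcal{B}_X$. *)

(* Defs.v *)
From HB Require Import structures.
From mathcomp Require Import all_boot all_order all_algebra.
From mathcomp Require Import all_classical all_reals all_analysis.
From mathcomp Require Import measurable_realfun.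

Set Implicit Arguments.
Unset Strict Implicit.
Unset Printing Implicit Defensive.

Import Order.TTheory GRing.Theory Num.Theory.
Import numFieldTopology.Exports.

Local Open Scope classical_set_scope.
Local Open Scope ring_scope.

(* The library only puts sigma-algebras on pointed types. A space carrying a
   probability measure is nonempty, so asking for a point loses nothing. *)
#[short(type="pmetricType")]
HB.structure Definition PointedMetric (K : numDomainType) :=
  { M of Pointed M & Metric K M }.

Definition borel (X : ptopologicalType) := g_sigma_algebraType (@open X).
HB.instance Definition _ (X : ptopologicalType) :=
  Measurable.copy (borel X) (g_sigma_algebraType (@open X)).

(* The library's L^2 is the quotient of the measurable functions of finite
   2-norm by almost everywhere equality, but it comes without a topology; we
   equip it with the distance of the 2-norm. Functions are real-valued. *)
Section L2.
Context d (T : measurableType d) (R : realType).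
Variable mu : {measure set T -> \bar R}.

Definition L2 : Type := LspaceType2 mu.
HB.instance Definition _ := gen_eqMixin L2.
HB.instance Definition _ := gen_choiceMixin L2.

(* a representative of the class f *)
Definition L2fun (f : L2) : T -> R :=
  repr (f : {mfun_ mu, T >-> measurableTypeR R}).

Lemma L2fun_measurable (f : L2) : measurable_fun setT (L2fun f).
Proof.
exact: (@measurable_funPT _ _ _ _
  (repr (f : {mfun_ mu, T >-> measurableTypeR R}))).
Qed.

Lemma L2fun_Lfun (f : L2) : L2fun f \in Lfun mu 2%:E.
Proof.
apply/andP; split; rewrite inE/=; first exact: L2fun_measurable.
exact: (@Lebesgue_finite _ _ _ _ _ _ f).
Qed.

Lemma ae_eq_Lnorm2 (f g : T -> R) :
  measurable_fun setT f -> measurable_fun setT g -> f = g %[ae mu] ->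
  'N[mu]_2%:E[EFin \o f]%E = 'N[mu]_2%:E[EFin \o g]%E.
Proof.
move=> mf mg fg; rewrite unlock; congr (_ `^ _)%E.
have mp (h : T -> R) : measurable_fun setT h ->
    measurable_fun setT (fun x => (`|h x| `^ 2)%:E).
  move=> mh; apply/measurable_EFinP.
  apply/(@measurableT_comp _ _ _ _ _ _ (fun x : R => x `^ 2)%R) => //.
  exact/measurableT_comp.
apply: ge0_ae_eq_integral => //.
- exact: mp.
- exact: mp.
- by move=> x _; exact: poweR_ge0.
- by move=> x _; exact: poweR_ge0.
by apply: filterS fg => x /= fgx _; rewrite fgx.
Qed.

(* `measurableTypeR R` and `R` have the same measurable sets but different
   displays, whence the explicit type arguments. *)
Section class.
Variables (f : T -> R) (f2 : f \in Lfun mu 2%:E).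

Let f_mfun : f \in @mfun _ _ T (measurableTypeR R).
Proof. by move: f2 => /andP[]; rewrite !inE. Qed.

Let fm : {mfun T >-> measurableTypeR R} :=
  @mfun_Sub _ _ T (measurableTypeR R) f f_mfun.

Let pif : {mfun_ mu, T >-> measurableTypeR R} :=
  (\pi_({mfun_ mu, T >-> measurableTypeR R}) fm)%qT.

Let pif_ae : (repr pif : T -> R) = f %[ae mu].
Proof.
have : (repr pif == fm %[mod {mfun_ mu, T >-> measurableTypeR R}])%qT.
  by rewrite reprK.
by rewrite eqmodE => /asboolP.
Qed.

Let pif_finite : finite_norm mu 2%:E (pif : T -> R).
Proof.
rewrite /finite_norm (_ : 'N[mu]_2%:E[_]%E = 'N[mu]_2%:E[EFin \o f]%E).
  by move: f2 => /andP[_]; rewrite inE.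
apply: ae_eq_Lnorm2 => //; first exact: (@measurable_funPT _ _ _ _ (repr pif)).
by move: f2 => /andP[]; rewrite inE.
Qed.

Definition L2class : L2 :=
  LebesgueSpace.Pack (LebesgueSpace.Class
    (@isFinLebesgue.Build _ _ _ mu _ (lee1n 2) pif pif_finite)).

Lemma L2classE : L2fun L2class = f %[ae mu].
Proof. exact: pif_ae. Qed.

End class.

Lemma L2_ae_eq (f g : L2) : L2fun f = L2fun g %[ae mu] -> f = g.
Proof.
case: f g => [f [[Hf]]] [g [[Hg]]] fg.
have E : f = g.
  rewrite -(reprK f) -(reprK g); apply/eqP; rewrite eqmodE.
  exact/asboolP.
by move: Hf fg; rewrite E => Hf _; rewrite (Prop_irrelevance Hf Hg).
Qed.

Lemma L2funB_Lfun (f g : L2) : L2fun f \- L2fun g \in Lfun mu 2%:E.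
Proof.
have e : L2fun f \- L2fun g =
    (Lfun_Sub (lee1n 2) (L2fun_Lfun f) - Lfun_Sub (lee1n 2) (L2fun_Lfun g) :
      LfunType mu (lee1n 2)) :> (T -> R) by [].
by rewrite e; exact: LfunP.
Qed.

Definition L2dist (f g : L2) : R :=
  fine 'N[mu]_2%:E[EFin \o (L2fun f \- L2fun g)%R]%E.

Lemma L2dist_EFin (f g : L2) :
  (L2dist f g)%:E = 'N[mu]_2%:E[EFin \o (L2fun f \- L2fun g)%R]%E.
Proof.
exact: (finite_norm_fine (Lfun_Sub (lee1n 2) (L2funB_Lfun f g))).
Qed.

Let L2distxx f : L2dist f f = 0.
Proof.
rewrite /L2dist (_ : _ \o _ = cst 0%E) ?Lnorm0//; last first.
by apply/funext => x /=; rewrite subrr.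
Qed.

Let L2dist_sep f g : L2dist f g = 0 -> f = g.
Proof.
move=> fg; apply: L2_ae_eq.
have := fine_Lnormr_eq0 (f := Lfun_Sub (lee1n 2) (L2funB_Lfun f g)) fg.
by apply: filterS => x /= /(_ I) /eqP; rewrite subr_eq0 => /eqP.
Qed.

Let L2dist_sym f g : L2dist f g = L2dist g f.
Proof.
have := LnormrN (Lfun_Sub (lee1n 2) (L2funB_Lfun g f)).
rewrite /L2dist => <-; congr (fine 'N[_]_(_)[_])%E.
by apply/funext => x /=; rewrite opprB.
Qed.

Let L2dist_triangle g f h : L2dist f h <= L2dist f g + L2dist g h.
Proof.
have := ler_LnormD (Lfun_Sub (lee1n 2) (L2funB_Lfun f g))
                   (Lfun_Sub (lee1n 2) (L2funB_Lfun g h)).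
apply: le_trans; rewrite /L2dist le_eqVlt; apply/orP; left; apply/eqP.
congr (fine 'N[_]_(_)[_])%E.
by apply/funext => x /=; rewrite addrA subrK.
Qed.

HB.instance Definition _ := @isMetric.Build R L2 L2dist L2distxx L2dist_sep
  L2dist_sym L2dist_triangle.

End L2.

Definition homeomorphism (X Y : topologicalType) (f : X -> Y) :=
  continuous f /\ exists g : Y -> X, [/\ cancel f g, cancel g f & continuous g].

Record mps (R : realType) (q : nat) := MPS {
  space :> pmetricType R;
  space_compact : compact [set: space];
  mps_measure : probability (borel space) R;
  mps_act : 'rV[int]_q -> space -> space;
  mps_homeo : forall w, homeomorphism (mps_act w);
  mps_actD : forall w u, mps_act w \o mps_act u = mps_act (w + u);
  mps_act0 : mps_act 0 = id;
  mps_invariant : forall w (A : set (borel space)), measurable A ->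
    mps_measure (mps_act w @^-1` A) = mps_measure A
}.

Section spectrum.
Context (R : realType) (q : nat) (M : mps R q).

Local Notation X := (borel M).
Local Notation mu := (mps_measure M).
Local Notation T := (@mps_act R q M).

Lemma mps_act_measurable w : measurable_fun [set: X] (T w : X -> X).
Proof.
have [cT _] := mps_homeo M w.
apply: measurability => //.
move=> _ [B oB <-]; rewrite setTI; apply: sub_sigma_algebra.
move/continuousP: cT; exact.
Qed.

Lemma comp_mps_act_Lnorm2 w (f : X -> R) : measurable_fun setT f ->
  'N[mu]_2%:E[EFin \o (f \o T w)]%E = 'N[mu]_2%:E[EFin \o f]%E.
Proof.
move=> mf; rewrite unlock; congr (_ `^ _)%E.
have mT := mps_act_measurable w.
have mp : measurable_fun setT (fun x => (`|f x| `^ 2)%:E).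
  apply/measurable_EFinP.
  apply/(@measurableT_comp _ _ _ _ _ _ (fun x : R => x `^ 2)%R) => //.
  exact/measurableT_comp.
have p0 : {in [set: X], forall x, (0 <= (`|f x| `^ 2)%:E)%E}.
  by move=> x _; rewrite lee_fin powR_ge0.
have := @ge0_integral_pushforward _ _ X X R (T w) mT mu setT _
  measurableT mp p0.
rewrite preimage_setT /= => <-.
apply: eq_measure_integral => //= A mA _.
by rewrite /pushforward; exact: mps_invariant.
Qed.

Lemma comp_mps_act_Lfun w (f : X -> R) :
  f \in Lfun mu 2%:E -> f \o T w \in Lfun mu 2%:E.
Proof.
move=> /andP[]; rewrite !inE/= => mf f2.
have mT := mps_act_measurable w.
apply/andP; split; rewrite inE/=; first exact: measurableT_comp.
by rewrite /finite_norm comp_mps_act_Lnorm2.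
Qed.

Lemma indic_Lfun (B : set X) : measurable B -> \1_B \in Lfun mu 2%:E.
Proof.
move=> mB; apply/andP; split; rewrite inE/=; first exact: measurable_indic.
rewrite /finite_norm unlock poweR_lty//.
rewrite (@eq_integral _ _ _ mu setT (fun x => (\1_B x)%:E)) => [|x _]; last first.
  rewrite /= indicE; case: (x \in B) => /=; first by rewrite normr1 powR1.
  by rewrite normr0 powR0.
by rewrite integral_indic// setIT (le_lt_trans (probability_le1 _ _)) ?ltry.
Qed.

Definition koopman w (f : L2 mu) : L2 mu :=
  L2class (comp_mps_act_Lfun w (L2fun_Lfun f)).

Lemma koopmanE w (f : L2 mu) : L2fun (koopman w f) = L2fun f \o T w %[ae mu].
Proof. exact: L2classE. Qed.

Definition orbit_on (L : set 'rV[int]_q) (f : L2 mu) : set (L2 mu) :=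
  [set koopman w f | w in L].

Definition kronecker_on (L : set 'rV[int]_q) : set (set X) :=
  [set B | exists mB : measurable B,
    compact (closure (orbit_on L (L2class (indic_Lfun mB))))].

Definition kronecker : set (set X) := kronecker_on setT.

Definition discrete_spectrum : Prop := kronecker = measurable.

End spectrum.

Arguments kronecker_on {R q} M L _.
Arguments kronecker {R q} M _.

(* Vectors of length q = n.+1 are indexed from 0: the distinguished first
   coordinate is `ord0`, the remaining q - 1 = n ones are `lift ord0 i`, and a
   width b in R^(q-1) is a row vector of length n. *)
Section directional_spectrum.
Context (R : realType) (n : nat).

Definition is_direction (v : 'rV[R]_n.+1) : Prop := v 0 ord0 = 1.

Definition strip (v : 'rV[R]_n.+1) (b : 'rV[R]_n) : set 'rV[int]_n.+1 :=
  [set m | forall i : 'I_n,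
    v 0 (lift ord0 i) * (m 0 ord0)%:~R - b 0 i / 2 <= (m 0 (lift ord0 i))%:~R
      <= v 0 (lift ord0 i) * (m 0 ord0)%:~R + b 0 i / 2].

Definition directional_kronecker (M : mps R n.+1) (v : 'rV[R]_n.+1)
    (b : 'rV[R]_n) : set (set (borel M)) :=
  kronecker_on M (strip v b).

Arguments directional_kronecker M v b _ : clear implicits.

Definition directional_discrete_spectrum (M : mps R n.+1) (v : 'rV[R]_n.+1)
    (b : 'rV[R]_n) : Prop :=
  directional_kronecker M v b = measurable.

End directional_spectrum.

(* Main.v *)
Require Import Defs.
From mathcomp Require Import all_boot all_order all_algebra.
From mathcomp Require Import all_classical all_reals all_analysis.
From mathcomp Require Import measurable_realfun.
From mathcomp Require Import ring lra zify.
Set Implicit Arguments.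
Unset Strict Implicit.
Unset Printing Implicit Defensive.
Import Order.TTheory GRing.Theory Num.Theory.
Import numFieldTopology.Exports.
Local Open Scope classical_set_scope.
Local Open Scope ring_scope.

(** Call a set [L] of shifts almost periodic if every orbit
    [{U^w 1_B : w in L}] of a measurable set [B] is relatively compact in L^2.
    Discrete spectrum says that the whole lattice is almost periodic, and
    [v]-discrete spectrum that the strip along [v] is. The easy implication is
    that almost periodicity passes to subsets, applied to any basis of
    directions.

    For the converse, two facts are combined.

    Analytically, almost periodicity is stable under sums of sets of shifts
    ([almost_periodic_onD]). If [w = k + l] runs along an ultrafilter, then
    [U^l 1_B] converges, since [L] is almost periodic, and its limit is again an
    indicator [1_C], since the indicators are closed in L^2 ([closure_indic]).
    As [K] is almost periodic, [U^k 1_C] converges too, and because [U^k] is an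
    isometry, [U^w 1_B] has the same limit. Convergence of the ultrafilters on
    the orbit itself is enough for its closure to be compact
    ([closure_compact_ultra]).

    Arithmetically, the strips along a basis of directions [v_i] cover the
    lattice up to a finite set ([strips_cover]): write a lattice point as
    [sum_i c_i v_i] with real [c_i] and replace each [c_i v_i] by a point of the
    [i]-th strip at bounded distance; the error is a lattice point in a fixed
    box. For narrow strips, the existence of such points is a recurrence
    property of rotations of the torus, obtained from the pigeonhole principle
    ([strip_syndetic]). *)

(** * Ultrafilters and relative compactness in metric spaces *)

Lemma ultra_fmap (T U : Type) (f : T -> U) (F : set_system T) :
  UltraFilter F -> UltraFilter (f @ F).
Proof.
move=> FU; split=> [|G GF fFG]; first exact: fmap_proper_filter.
rewrite predeqE => A; split=> [GA|]; last exact: fFG.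
have [//|FnA] := in_ultra_setVsetC (f @^-1` A) FU.
have GnA : G (~` A) by apply: fFG.
have /filter_ex[x []] : G (A `&` ~` A) by exact: filterI.
by [].
Qed.

(** A filter on [closure A] need not restrict to one on [A], but it can be
    thickened: the points of [A] within [e] of a set of [F] generate a filter,
    and a limit of a finer ultrafilter is a cluster point of [F]. *)
Lemma closure_compact_ultra (R : realType) (T : metricType R) (A : set T) :
  (forall U : set_system T, UltraFilter U -> U A -> exists p : T, U --> p) ->
  compact (closure A).
Proof.
move=> cvgA F FF FclA.
pose thick (B : set T) (e : R) := A `&` [set y | exists2 x, B x & ball x e y].
pose base := [set Be : set T * R | F Be.1 /\ 0 < Be.2].
pose G := filter_from base (fun Be => thick Be.1 Be.2).
have GF : ProperFilter G.
  apply: filter_from_proper; last first.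
    move=> [B e] [/= FB e0].
    have /filter_ex[x [Bx clAx]] : F (B `&` closure A) by exact: filterI.
    have [y [Ay xy]] := clAx _ (nbhsx_ballx x e e0).
    by exists y; split => //; exists x.
  apply: filter_from_filter.
    by exists (setT, 1); split; [exact: filterT|].
  move=> [B e] [C d] [/= FB e0] [/= FC d0].
  exists (B `&` C, Num.min e d).
    by split=> /=; [exact: filterI|rewrite lt_min e0].
  move=> y [Ay [x [Bx Cx] /= xy]]; split; split => //; exists x => //.
    by apply: le_ball xy; rewrite ge_min lexx.
  by apply: le_ball xy; rewrite ge_min lexx orbT.
have [U [UU GU]] := ultraFilterLemma GF.
have UA : U A.
  apply: GU; exists (setT, 1); first by split; [exact: filterT|].
  by move=> y [].
have [p Up] := cvgA U UU UA.
exists p; split.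
  by move=> V /Up UV; apply: (@filter_ex _ U); exact: filterI.
move=> B V FB /nbhs_ballP[e /= e0 peV].
have e20 : 0 < e / 2 by rewrite divr_gt0.
have UB : U (thick B (e / 2)) by apply: GU; exists (B, e / 2).
have Uball : U (ball p (e / 2)) by apply: Up; exact: nbhsx_ballx.
have /filter_ex[y [[_ [x Bx xy]] py]] : U (thick B (e / 2) `&` ball p (e / 2)).
  exact: filterI.
exists x; split => //; apply: peV; rewrite [e]splitr.
by apply: ball_triangle py _; exact: ball_sym.
Qed.

(** * Indicators and Koopman operators in L^2 *)

Section Lnorm2.
Context d (T : measurableType d) (R : realType).
Variable mu : {measure set T -> \bar R}.

Lemma le_Lnorm2 (f g : T -> R) :
    measurable_fun setT f -> measurable_fun setT g ->
    (forall x, `|f x| <= `|g x|) ->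
  ('N[mu]_2%:E[EFin \o f] <= 'N[mu]_2%:E[EFin \o g])%E.
Proof.
move=> mf mg fg.
have mp (h : T -> R) : measurable_fun setT h ->
    measurable_fun setT (fun x => (`|h x| `^ 2)%:E).
  move=> mh; apply/measurable_EFinP.
  apply/(@measurableT_comp _ _ _ _ _ _ (fun x : R => x `^ 2)%R) => //.
  exact/measurableT_comp.
have int_ge0 (h : T -> R) :
    (0 <= \int[mu]_x `|(EFin \o h) x| `^ 2)%E.
  by apply: integral_ge0 => x _; exact: poweR_ge0.
rewrite unlock; apply: gt0_ler_poweR; first by rewrite invr_ge0.
- by rewrite in_itv/= int_ge0 leey.
- by rewrite in_itv/= int_ge0 leey.
apply: ge0_le_integral => //.
- by move=> x _; exact: poweR_ge0.
- exact: mp.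
- exact: mp.
by move=> x _; rewrite lee_fin ge0_ler_powR ?nnegrE.
Qed.

End Lnorm2.

Section koopman.
Context (R : realType) (q : nat) (M : mps R q).
Local Notation X := (borel M).
Local Notation mu := (mps_measure M).
Local Notation T := (@mps_act R q M).
Local Notation indic mB := (L2class (indic_Lfun (M := M) mB)).

Lemma ae_eq_comp_act w (f g : X -> R) :
  f = g %[ae mu] -> f \o T w = g \o T w %[ae mu].
Proof.
move=> [N [mN N0 fgN]]; exists (T w @^-1` N); split.
- by rewrite -[X in measurable X]setTI; exact: mps_act_measurable.
- by rewrite mps_invariant.
- by move=> x /= fgx; apply: fgN.
Qed.

Lemma koopmanD w u (f : L2 mu) : koopman w (koopman u f) = koopman (w + u) f.
Proof.
apply: L2_ae_eq; rewrite addrC.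
have h1 := koopmanE w (koopman u f).
have h2 := koopmanE (u + w) f.
have h3 := ae_eq_comp_act w (koopmanE u f).
apply: filterS3 h1 h2 h3 => x e1 e2 e3 xT.
rewrite e1// e2// e3//=.
by rewrite -mps_actD.
Qed.

Lemma mdistL2E (f g : L2 mu) :
  (mdist f g)%:E = 'N[mu]_2%:E[EFin \o (L2fun f \- L2fun g)%R]%E.
Proof. exact: L2dist_EFin. Qed.

Lemma mdist_koopman w (f g : L2 mu) :
  mdist (koopman w f) (koopman w g) = mdist f g.
Proof.
apply: EFin_inj; rewrite !mdistL2E.
have mB (h k : L2 mu) : measurable_fun setT (L2fun h \- L2fun k).
  by apply: measurable_funB; exact: L2fun_measurable.
rewrite -[RHS](comp_mps_act_Lnorm2 w); last exact: mB.
apply: ae_eq_Lnorm2.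
- exact: mB.
- apply: measurableT_comp; first exact: mB.
  exact: mps_act_measurable.
apply: filterS2 (koopmanE w f) (koopmanE w g) => x e1 e2 xT /=.
by rewrite e1// e2.
Qed.

(** Pointwise, rounding [g x] to the nearer of 0 and 1 is at least as close to
    [g x] as any other choice of 0 or 1. *)
Lemma mdist_superlevel_indic (g : L2 mu)
    (mC : measurable [set x | 1/2 < L2fun g x])
    (B : set X) (mB : measurable B) :
  mdist (indic mC) g <= mdist (indic mB) g.
Proof.
have mg := @L2fun_measurable _ _ _ _ g.
have normE (D : set X) (mD : measurable D) : (mdist (indic mD) g)%:E =
    'N[mu]_2%:E[EFin \o (\1_D \- L2fun g)%R]%E.
  rewrite mdistL2E; apply: ae_eq_Lnorm2.
  - by apply: measurable_funB => //; exact: L2fun_measurable.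
  - exact: measurable_funB.
  by apply: filterS (L2classE (indic_Lfun mD)) => x e1 xT /=; rewrite e1.
rewrite -lee_fin !normE; set C := [set x | _] in mC *.
apply: le_Lnorm2 => [||x].
- exact: measurable_funB.
- exact: measurable_funB.
rewrite /= !indicE.
have [|] := boolP (x \in C); rewrite ?notin_setE ?inE /C/= => gx;
  case: (x \in B) => //=.
- by rewrite sub0r normrN [leRHS]ger0_norm ?ler_norml; lra.
- move/negP: gx; rewrite -leNgt => gx.
  by rewrite sub0r normrN [leRHS]ger0_norm ?ler_norml; lra.
Qed.

(** A limit of indicators is the indicator of its own superlevel set, which
    approximates it at least as well as any of them. *)
Lemma closure_indic (O : set (L2 mu)) (g : L2 mu) :
    (forall f, O f -> exists (B : set X) (mB : measurable B), f = indic mB) ->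
  closure O g -> exists (B : set X) (mB : measurable B), g = indic mB.
Proof.
move=> Oindic Og.
have mC : measurable [set x | 1/2 < L2fun g x].
  have mg := @L2fun_measurable _ _ _ _ g.
  rewrite -[X in measurable X]setTI.
  rewrite (_ : [set x | _] = L2fun g @^-1` `]1/2, +oo[); last first.
    by apply/seteqP; split=> x /=; rewrite in_itv/= andbT.
  exact: mg.
exists _, mC; apply/esym/mdist_positivity/eqP; rewrite eq_le mdist_ge0 andbT.
apply/ler_addgt0Pl => e e0; rewrite addr0.
have [_ [/Oindic[B [mB ->]]]] := Og _ (nbhsx_ballx g e e0).
rewrite ballEmdist/= metric_sym => /ltW; apply: le_trans.
exact: mdist_superlevel_indic.
Qed.

Lemma koopman_indic w (B : set X) (mB : measurable B) :
  exists (C : set X) (mC : measurable C), koopman w (indic mB) = indic mC.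
Proof.
have mC : measurable (T w @^-1` B : set X).
  by rewrite -[X in measurable X]setTI; exact: mps_act_measurable.
exists _, mC; apply: L2_ae_eq.
have h3 := ae_eq_comp_act w (L2classE (indic_Lfun mB)).
apply: filterS3 (koopmanE w (indic mB)) h3 (L2classE (indic_Lfun mC)).
by move=> x e1 e2 e3 xT; rewrite e1// e2// e3.
Qed.

(** * Almost periodic sets of shifts *)

Definition almost_periodic_on (L : set 'rV[int]_q) : Prop :=
  forall (B : set X) (mB : measurable B),
    compact (closure (orbit_on L (indic mB))).

Lemma almost_periodic_onS (L L' : set 'rV[int]_q) :
  L' `<=` L -> almost_periodic_on L -> almost_periodic_on L'.
Proof.
move=> L'L apL B mB; apply: subclosed_compact (apL B mB) _.
  exact: closed_closure.
by apply: closureS; exact: image_subset.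
Qed.

Lemma almost_periodic_on_finite (L : set 'rV[int]_q) :
  finite_set L -> almost_periodic_on L.
Proof.
move=> finL B mB.
have cO : compact (orbit_on L (indic mB)).
  by apply: finite_compact; exact: finite_image.
rewrite -(closure_id _).1//; apply: compact_closed => //.
exact: metric_hausdorff.
Qed.

(** The limits along an ultrafilter are taken in two steps, [U^l 1_B] first. Its
    limit has to be an indicator for the hypothesis on [K] to apply to it. *)
Lemma almost_periodic_onD (K L : set 'rV[int]_q) :
    almost_periodic_on K -> almost_periodic_on L ->
  almost_periodic_on [set k + l | k in K & l in L].
Proof.
move=> apK apL B mB; apply: closure_compact_ultra => U UU UO.
pose f0 := indic mB; pose O := orbit_on [set k + l | k in K & l in L] f0.
have /choice[s sE] (f : L2 mu) : exists w : 'rV[int]_q * 'rV[int]_q,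
    O f -> [/\ K w.1, L w.2 & f = koopman (w.1 + w.2) f0].
  have [[_ [k Kk [l Ll <-]] <-]|nO] := pselect (O f); first by exists (k, l).
  by exists (0, 0).
have cvg_orbit (J : set 'rV[int]_q) (r : L2 mu -> 'rV[int]_q)
    (C : set X) (mC : measurable C) :
    almost_periodic_on J -> U (r @^-1` J) ->
    exists2 g, closure (orbit_on J (indic mC)) g &
      (fun f => koopman (r f) (indic mC)) @ U --> g.
  move=> apJ UJ; have := apJ C mC; rewrite compact_ultra.
  have V := ultra_fmap (fun f => koopman (r f) (indic mC)) UU.
  move=> /(_ _ V)[|g [clg Vg]]; last by exists g.
  apply: (@filterS _ U _ _ _ _ UJ) => f /= Jr; apply: subset_closure.
  by exists (r f).
have [g clg Ug] : exists2 g, closure (orbit_on L f0) g &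
    (fun f => koopman (s f).2 f0) @ U --> g.
  apply: (cvg_orbit L (fun f => (s f).2) B mB apL).
  by apply: filterS UO => f /sE[].
have [C [mC gE]] : exists (C : set X) (mC : measurable C), g = indic mC.
  by apply: closure_indic clg => _ [w _ <-]; exact: koopman_indic.
have [h _ Uh] : exists2 h, closure (orbit_on K (indic mC)) h &
    (fun f => koopman (s f).1 (indic mC)) @ U --> h.
  apply: (cvg_orbit K (fun f => (s f).1) C mC apK).
  by apply: filterS UO => f /sE[].
exists h => V /nbhs_ballP[e /= e0 heV].
have e20 : 0 < e / 2 by rewrite divr_gt0.
have Uk := Uh _ (nbhsx_ballx h _ e20).
have Ul := Ug _ (nbhsx_ballx g _ e20).
apply: (@filterS3 _ U _ _ _ _ _ _ UO Uk Ul) => f /sE[_ _ fE] /=.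
rewrite !ballEmdist/= => dk dl; apply: heV; rewrite ballEmdist/=.
apply: le_lt_trans (metric_triangle _ (koopman (s f).1 (indic mC)) _) _.
rewrite [X in _ + mdist _ X]fE -koopmanD mdist_koopman -gE [e]splitr.
by apply: ltrD; rewrite // gE.
Qed.

Lemma almost_periodic_on_sum (I : finType) (L : I -> set 'rV[int]_q) :
    (forall i, almost_periodic_on (L i)) ->
  almost_periodic_on [set \sum_i w i | w in [set w | forall i, L i (w i)]].
Proof.
move=> apL.
suff ap (r : seq I) : almost_periodic_on
    [set \sum_(i <- r) w i | w in [set w | forall i, L i (w i)]] by exact: ap.
elim: r => [|i r IHr].
  apply: almost_periodic_on_finite; apply: sub_finite_set (finite_set1 0).
  by move=> _ [w _ <-]; rewrite big_nil.
apply: almost_periodic_onS (almost_periodic_onD (apL i) IHr).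
move=> _ [w Lw <-]; rewrite big_cons; exists (w i) => //.
by exists (\sum_(j <- r) w j) => //; exists w.
Qed.

Lemma kronecker_on_measurable (L : set 'rV[int]_q) :
  kronecker_on M L = measurable <-> almost_periodic_on L.
Proof.
split=> [KL B mB|apL].
  have [mB' cB] : kronecker_on M L B by rewrite KL.
  by rewrite (Prop_irrelevance mB mB').
apply/seteqP; split=> B; first by case.
by move=> mB; exists mB; exact: apL.
Qed.

End koopman.

(** * Strips along a basis of directions *)

Lemma free_row_free (F : fieldType) (m n : nat) (v : 'I_m -> 'rV[F]_n) :
  free [seq v i | i : 'I_m] = row_free (\matrix_i v i).
Proof.
have sz : size [seq v i | i : 'I_m] == m by rewrite size_map size_enum_ord.
have nthv (i : 'I_m) : [seq v i | i : 'I_m]`_i = v i.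
  by rewrite (nth_map i) ?size_enum_ord// nth_ord_enum.
have := @freeP _ _ m (Tuple sz); rewrite /= => fP.
apply/fP/idP => [vfree|vfree k k0 i].
  apply: inj_row_free => k kV; apply/rowP => i; rewrite mxE.
  apply: (vfree (fun i => k 0 i)); rewrite -[RHS]kV mulmx_sum_row.
  by apply: eq_bigr => j _; rewrite nthv rowK.
have kV : (\row_i k i) *m (\matrix_i v i) = 0 *m (\matrix_i v i).
  rewrite mul0mx mulmx_sum_row -[RHS]k0; apply: eq_bigr => j _.
  by rewrite mxE rowK nthv.
by have /rowP/(_ i) := row_free_inj vfree kV; rewrite !mxE.
Qed.

Section strip.
Context (R : realType) (n : nat).
Implicit Types v : 'rV[R]_n.+1.

(** Cut the unit cube into cubes of side [1 / N.+1], at most half the least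
    width. If the fractional parts of [k v] and [l v] lie in the same cube, then
    the difference of the integer parts of [k v] and [l v] lies in the strip.
    Fix one integer in each of the finitely many cubes that are visited:
    subtracting from [k] the one in its own cube lands in the strip and moves
    the point by a bounded amount only. *)
Lemma strip_syndetic v (b : 'rV[R]_n) :
    is_direction v -> (forall i, 0 < b 0 i) ->
  exists C : R, forall c : R, exists2 w : 'rV[int]_n.+1, strip v b w &
    forall j, `|c * v 0 j - (w 0 j)%:~R| <= C.
Proof.
move=> v1 b_gt0.
have [N Nb] : exists N : nat, forall i, N.+1%:R^-1 <= b 0 i / 2.
  exists (\max_(i < n) Num.bound (2 / b 0 i)%R) => i.
  have b0 := b_gt0 i.
  rewrite -[leRHS]invrK lef_pV2 ?posrE ?ltr0n ?invr_gt0 ?divr_gt0// invf_div.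
  apply: le_trans (ltW (archi_boundP _)) _; first by rewrite divr_ge0// ltW.
  by rewrite ler_nat ltnW// ltnS (leq_bigmax i).
pose fl (k : int) : 'rV[int]_n.+1 := \row_j Num.floor (k%:~R * v 0 j).
pose frac (k : int) j : R := k%:~R * v 0 j - (fl k 0 j)%:~R.
have frac_itv k j : 0 <= frac k j < 1.
  rewrite /frac /fl mxE.
  have /andP[] := floor_itv (k%:~R * v 0 j).
  by rewrite intrD1; lra.
pose cell k : {ffun 'I_n.+1 -> 'I_N.+1} :=
  [ffun j => inord (Num.truncn (N.+1%:R * frac k j))].
have cellE k j : (cell k j)%:R <= N.+1%:R * frac k j < (cell k j).+1%:R.
  have /andP[f0 f1] := frac_itv k j.
  have Nf0 : 0 <= N.+1%:R * frac k j by rewrite mulr_ge0.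
  rewrite ffunE inordK ?truncn_itv// -(ltr_nat R).
  have /andP[tr _] := truncn_itv Nf0.
  by apply: le_lt_trans tr _; rewrite gtr_pMr.
have /choice[rep repP] (a : {ffun 'I_n.+1 -> 'I_N.+1}) :
    exists r : int, forall k, cell k = a -> cell r = a.
  have [[r ra]|na] := pselect (exists r, cell r = a); first by exists r.
  by exists 0 => k ka; case: na; exists k.
(* The first coordinate of [v] is 1, so rounding [k v] down keeps its first
   coordinate [k], the one that the strip condition refers to. *)
have fl0 k : fl k 0 ord0 = k.
  by rewrite !mxE v1 mulr1 intrKfloor.
have cell_strip k l : cell k = cell l -> strip v b (fl k - fl l).
  move=> kl i; set j := lift ord0 i.
  have wE (m : 'I_n.+1) : ((fl k - fl l) 0 m)%:~R =
      (fl k 0 m)%:~R - (fl l 0 m)%:~R :> R by rewrite !mxE rmorphB.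
  have : `|frac k j - frac l j| <= N.+1%:R^-1.
    have := cellE k j; have := cellE l j; rewrite kl -[(cell l j).+1%:R]natr1.
    move=> /andP[? ?] /andP[? ?].
    rewrite -[leRHS]mulr1 ler_pdivlMl ?ltr0n//.
    rewrite -[X in X * _](ger0_norm (ler0n R N.+1)) -normrM ler_norml.
    by rewrite mulrBr; lra.
  move=> /le_trans/(_ (Nb i)); rewrite ler_norml !wE !fl0 /frac; lra.
(* [|v_j|] pays for rounding [c] to [k], [1] for the fractional part of
   [k v_j], and the last sum for the representative. *)
pose C := \sum_j (`|v 0 j| + 1 + \sum_a `|(fl (rep a) 0 j)%:~R : R|).
exists C => c; pose k := Num.floor c; pose r := rep (cell k).
exists (fl k - fl r); first by apply: cell_strip; rewrite (repP _ k).
move=> j; pose D i : R := `|v 0 i| + 1 + \sum_a `|(fl (rep a) 0 i)%:~R : R|.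
have D0 i : 0 <= D i by rewrite !addr_ge0// sumr_ge0.
have DC : D j <= C.
  by rewrite /C (bigD1 j)//= lerDl sumr_ge0// => i _; exact: D0.
apply: le_trans DC; rewrite /D.
have flr : `|(fl r 0 j)%:~R : R| <= \sum_a `|(fl (rep a) 0 j)%:~R : R|.
  by rewrite (bigD1 (cell k))//= lerDl sumr_ge0.
have -> : c * v 0 j - ((fl k - fl r) 0 j)%:~R =
    (c - k%:~R) * v 0 j + frac k j + (fl r 0 j)%:~R.
  rewrite /frac [(_ - fl r) 0 j]mxE [(- fl r) 0 j]mxE rmorphD rmorphN/=.
  by ring.
apply: le_trans (ler_normD _ _) _.
apply: (lerD _ flr).
apply: le_trans (ler_normD _ _) _; apply: lerD.
  rewrite normrM ler_piMl//.
  have /andP[] := floor_itv c; rewrite -/k intrD1 => ? ?.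
  by rewrite ger0_norm; lra.
have /andP[f0 f1] := frac_itv k j; rewrite ger0_norm; [exact: ltW|exact: f0].
Qed.

Lemma finite_int_box (C : R) :
  finite_set [set m : 'rV[int]_n.+1 | forall j, `|(m 0 j)%:~R : R| <= C].
Proof.
pose N := Num.bound C.
pose row_of (f : {ffun 'I_n.+1 -> 'I_(N + N).+1}) : 'rV[int]_n.+1 :=
  \row_j ((f j : nat)%:Z - N%:Z).
apply: (@sub_finite_set _ _ (range row_of)); last first.
  by apply: finite_image; exact: finite_finset.
move=> m mC; have mN j : (`|m 0 j| < N%:Z).
  rewrite -(ltr_int R) intr_norm; apply: le_lt_trans (mC j) _.
  by apply: archi_boundP; apply: le_trans (mC j).
exists [ffun j : 'I_n.+1 => inord `|(m 0 j + N%:Z)%R|%N] => //.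
apply/rowP => j; rewrite !mxE ffunE inordK; have := mN j; lia.
Qed.

(** Narrowing a strip to width [b] costs only a larger error, and lattice points
    of bounded error form a finite set. *)
Lemma strips_cover (v : 'I_n.+1 -> 'rV[R]_n.+1) (b : 'I_n.+1 -> 'rV[R]_n) :
    free [seq v i | i : 'I_n.+1] -> (forall i, is_direction (v i)) ->
    (forall i j, 0 < b i 0 j) ->
  exists2 F : set 'rV[int]_n.+1, finite_set F & forall m, exists f w,
   [/\ F f, (forall i, strip (v i) (b i) (w i)) & m = f + \sum_i w i].
Proof.
move=> vfree vdir b_gt0.
have /choice[C CP] i := strip_syndetic (vdir i) (b_gt0 i).
pose V := \matrix_i v i.
have uV : V \in unitmx by rewrite -row_free_unit -free_row_free.
exists [set m : 'rV[int]_n.+1 | forall j, `|(m 0 j)%:~R : R| <= \sum_i C i].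
  exact: finite_int_box.
move=> m; pose c := map_mx intr m *m invmx V : 'rV[R]_n.+1.
have mE j : (m 0 j)%:~R = \sum_i c 0 i * v i 0 j.
  have : c *m V = map_mx intr m by rewrite mulmxKV.
  move=> /rowP/(_ j); rewrite [RHS]mxE => <-; rewrite mxE.
  by apply: eq_bigr => i _; rewrite !mxE.
have /choice[w wP] i : exists w, strip (v i) (b i) w /\
    forall j, `|c 0 i * v i 0 j - (w 0 j)%:~R| <= C i.
  by have [w ? ?] := CP i (c 0 i); exists w.
exists (m - \sum_i w i), w; split; last by rewrite subrK.
- move=> j /=; rewrite !mxE summxE rmorphB/= mE rmorph_sum/= -sumrB.
  apply: le_trans (ler_norm_sum _ _ _) _; apply: ler_sum => i _.
  exact: (wP i).2.
- by move=> i; exact: (wP i).1.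
Qed.

End strip.

(** The standard basis with its first vector added to all the others. *)
Lemma free_directions (R : realType) (n : nat) :
  exists v : 'I_n.+1 -> 'rV[R]_n.+1,
    free [seq v i | i : 'I_n.+1] /\ forall i, is_direction (v i).
Proof.
exists (fun i => \row_j ((j == ord0) || (j == i))%:R).
split=> [|i]; last by rewrite /is_direction mxE eqxx.
rewrite free_row_free; apply: inj_row_free => k /rowP kV.
have kjE j : \sum_i k 0 i * ((j == ord0) || (j == i))%:R = 0.
  have := kV j; rewrite !mxE => kVj; rewrite -[RHS]kVj.
  by apply: eq_bigr => i _; rewrite !mxE.
have k_neq0 j : j != ord0 -> k 0 j = 0.
  move=> /negbTE j0; rewrite -[RHS](kjE j) (bigD1 j)//= eqxx orbT mulr1.
  rewrite big1 ?addr0// => i; rewrite eq_sym => /negbTE ij.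
  by rewrite j0 ij mulr0.
apply/rowP => j; rewrite mxE; have [->|/k_neq0//] := eqVneq j ord0.
rewrite -[RHS](kjE ord0) (bigD1 ord0)//= mulr1 big1 ?addr0// => i i0.
by rewrite k_neq0// mul0r.
Qed.

(* The directional Kronecker algebra does not depend on the width used to define
   it; [b v] is an arbitrary choice of width for each direction [v]. *)
Theorem theoremB6 (R : realType) (n : nat) (q_ge2 : (2 <= n.+1)%N)
    (M : mps R n.+1)
    (b : 'rV[R]_n.+1 -> 'rV[R]_n) (b_gt0 : forall v i, 0 < b v 0 i) :
  (exists v : 'I_n.+1 -> 'rV[R]_n.+1,
     [/\ free [seq v i | i : 'I_n.+1],
         forall i, is_direction (v i)
       & forall i, directional_discrete_spectrum M (v i) (b (v i))])
  <-> discrete_spectrum M.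
Proof.
split=> [[v [vfree vdir vds]]|/kronecker_on_measurable ap]; last first.
  have [v [vfree vdir]] := free_directions R n.
  exists v; split=> // i; apply/kronecker_on_measurable.
  exact: almost_periodic_onS ap.
have [F finF cover] := strips_cover vfree vdir (fun i => b_gt0 (v i)).
have apS : almost_periodic_on M
    [set \sum_i w i | w in [set w | forall i, strip (v i) (b (v i)) (w i)]].
  apply: (@almost_periodic_on_sum _ _ M _ (fun i => strip (v i) (b (v i)))) => i.
  exact/kronecker_on_measurable/vds.
apply/(kronecker_on_measurable M setT).
have apFS := almost_periodic_onD (almost_periodic_on_finite finF) apS.
apply: almost_periodic_onS apFS => m _.
have [f [w [Ff Sw ->]]] := cover m.
by exists f => //; exists (\sum_i w i) => //; exists w.
Qed.
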